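(* Let $\Gamma$ be an infinite, finitely generated, residually finite group. Then $i_\Gamma(n) \geq n$ for infinitely many positive integers $n$.
   Context: For a group $\Gamma$ and a positive integer $n$, let $\Lambda_\Gamma(n)$ denote the intersection of all subgroups $\Delta \le \Gamma$ with index $[\Gamma:\Delta] \le n$. The intersection growth function of $\Gamma$ is $i_\Gamma(n) := [\Gamma : \Lambda_\Gamma(n)]$. A group is residually finite if the intersection of all its finite index subgroups is trivial. *)

(* Defs.v *)
From HB Require Import structures.
From mathcomp Require Import all_boot finmap all_classical.

Set Implicit Arguments.
Unset Strict Implicit.
Unset Printing Implicit Defensive.

Local Open Scope classical_set_scope.
Local Open Scope group_scope.

Definition subgroup (G : groupType) (D : set G) : Prop :=
  group_closed (mem D).

Definition left_cosets (G : groupType) (D : set G) : set (set G) :=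
  range (fun x : G => [set x * d | d in D]).

Definition finite_index (G : groupType) (D : set G) : Prop :=
  finite_set (left_cosets D).

(* Since [fset_set] is empty on infinite sets, [subgroup_index D] is 0 when [D]
   has infinite index.  Upper bounds on it are therefore always paired with
   [finite_index D]; a bound [0 < n <= subgroup_index D] already implies it. *)
Definition subgroup_index (G : groupType) (D : set G) : nat :=
  #|` fset_set (left_cosets D) |.

Definition finitely_generated (G : groupType) : Prop :=
  exists2 S : set G, finite_set S & smallest (@subgroup G) S = [set: G].

Definition residually_finite (G : groupType) : Prop :=
  \bigcap_(D in [set D : set G | subgroup D /\ finite_index D]) D
    = [set 1 : G].

Definition Lambda (G : groupType) (n : nat) : set G :=
  \bigcap_(D in [set D : set G |
    [/\ subgroup D, finite_index D & subgroup_index D <= n]]) D.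

Definition intersection_growth (G : groupType) (n : nat) : nat :=
  subgroup_index (@Lambda G n).

(* Main.v *)
Require Import Defs.
From mathcomp Require Import all_boot finmap all_classical.

Local Open Scope classical_set_scope.

(** If [D] is a subgroup of finite index [m], then [Lambda G m] is contained in
    [D], so its index is at least [m], provided that this index is finite (for
    [subgroup_index] is 0 otherwise).  Hence every index of a finite index
    subgroup is an [n] as required, and two facts remain.

    - [Lambda G n] has finite index.  A finitely generated group has finitely
      many subgroups of index at most [n] ([finite_small_index_subgroups]): such
      a subgroup is a point stabilizer for an action on its cosets, and an
      action on a set of bounded size is determined by finitely many
      permutations, those of the generators.
    - Finite indices are unbounded ([large_index]).  Given [n] elements of an
      infinite residually finite group, some finite index subgroup [D] avoids
      the finitely many quotients [x^-1 * y] of distinct ones, so that these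
      [n] elements lie in distinct left cosets of [D]. *)

Section Subgroups.
Context {G : groupType}.
Local Open Scope group_scope.
Implicit Types (D H K : set G) (x y g : G).

Lemma subgroup1 D : subgroup D -> D 1.
Proof. by move=> [D1 _]; apply: set_mem. Qed.

Lemma subgroupV D x : subgroup D -> D x -> D x^-1.
Proof. by move=> /group_closedV DV Dx; apply/set_mem/DV/mem_set. Qed.

Lemma subgroupM D x y : subgroup D -> D x -> D y -> D (x * y).
Proof.
by move=> /group_closedM DM Dx Dy; apply/set_mem/DM; apply/mem_set.
Qed.

Lemma subgroupP D :
  D 1 -> (forall x y, D x -> D y -> D (x / y)) -> subgroup D.
Proof.
move=> D1 DB; split=> [|x y /set_mem Dx /set_mem Dy]; apply/mem_set => //.
exact: DB.
Qed.

Lemma subgroup_bigcap (F : set (set G)) :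
  F `<=` @subgroup G -> subgroup (\bigcap_(D in F) D).
Proof.
move=> Fsub; apply: subgroupP => [D /Fsub/subgroup1//|x y Fx Fy D FD].
by apply: subgroupM (Fx _ FD) (subgroupV _ _ _ (Fy _ FD)); apply: Fsub.
Qed.

Lemma eq_left_coset D x y : subgroup D ->
  [set x * d | d in D] = [set y * d | d in D] <-> D (x^-1 * y).
Proof.
move=> sD; split=> [eqxy|Dxy].
  have : [set y * d | d in D] y.
    by exists 1; [exact: subgroup1|rewrite mulg1].
  by rewrite -eqxy => -[d Dd <-]; rewrite mulKg.
apply/seteqP; split=> _ [d Dd <-].
  exists ((x^-1 * y)^-1 * d); first by apply: subgroupM => //; exact: subgroupV.
  by rewrite invgM invgK !mulgA mulgV mul1g.
exists (x^-1 * y * d); first exact: subgroupM.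
by rewrite !mulgA mulgV mul1g.
Qed.

Lemma left_coset_mul H K x : subgroup H -> subgroup K -> H `<=` K ->
  [set y * k | y in [set x * h | h in H] & k in K] = [set x * k | k in K].
Proof.
move=> sH sK HK; apply/seteqP; split=> z.
  move=> [_ [h Hh <-]] [k Kk <-]; exists (h * k); last by rewrite mulgA.
  by apply: subgroupM => //; exact: HK.
move=> [k Kk <-]; exists x; last by exists k.
by exists 1; [exact: subgroup1|rewrite mulg1].
Qed.

(** The map [A |-> A K] sends the left cosets of [H] onto those of [K]. *)
Lemma leq_subgroup_index H K : subgroup H -> subgroup K -> H `<=` K ->
  finite_index H -> subgroup_index K <= subgroup_index H.
Proof.
move=> sH sK HK fH.
pose mulK (A : set G) := [set y * k | y in A & k in K].
have -> : subgroup_index K = #|` fset_set (mulK @` left_cosets H)|.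
  congr #|` fset_set _|; rewrite /left_cosets image_comp.
  by apply: eq_imagel => x _; rewrite /mulK /= left_coset_mul.
by rewrite fset_set_image//; exact: leq_imfset_card.
Qed.

Lemma finite_indexT : finite_index [set: G].
Proof.
apply: (sub_finite_set _ (finite_set1 [set: G])) => _ [x _ <-] /=.
by apply/seteqP; split=> // y _; exists (x^-1 * y) => //; rewrite mulVKg.
Qed.

(** Each left coset of the intersection is the intersection of a left coset of
    [H] and one of [K]. *)
Lemma finite_indexI H K :
  finite_index H -> finite_index K -> finite_index (H `&` K).
Proof.
move=> fH fK; rewrite /finite_index /left_cosets.
have -> : (fun x => [set x * d | d in H `&` K]) =
          (fun x => [set x * d | d in H] `&` [set x * d | d in K]).
  apply/funext => x; apply/seteqP; split=> [_ [d [Hd Kd] <-]|z].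
    by split; exists d.
  by move=> [[h Hh <-]] [k Kk /mulgI kh]; exists h => //; split; rewrite // -kh.
exact: finite_image11.
Qed.

Lemma finite_index_bigcap (F : set (set G)) : finite_set F ->
  F `<=` @finite_index G -> finite_index (\bigcap_(D in F) D).
Proof.
move=> /finite_seqP[s ->] sfin; rewrite bigcap_seq big_seq.
by apply: big_ind; [exact: finite_indexT|exact: finite_indexI|exact: sfin].
Qed.

(** A labelling [c] of the left cosets by a type that depends only on the bound
    [n], so that the coset actions of different subgroups can be compared.  The
    bound [n.+1] spares the case [n = 0]; labels need not all be used. *)
Lemma coset_labelling D n : subgroup D -> finite_index D ->
  subgroup_index D <= n ->
  exists c : G -> 'I_n.+1, forall x y, c x = c y <-> D (x^-1 * y).
Proof.
move=> sD fD leDn.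
pose C := fset_set (left_cosets D).
pose coset x := [set x * d | d in D].
have CP x : coset x \in C by rewrite in_fset_set//; apply/mem_set; exists x.
have ltn x : index (coset x) C < n.+1.
  by rewrite ltnS; apply/ltnW/(leq_trans _ leDn); rewrite index_mem.
exists (fun x => Ordinal (ltn x)) => x y; rewrite -eq_left_coset//.
split=> [[]|eqxy]; last by apply: val_inj; rewrite /= /coset eqxy.
exact: index_inj.
Qed.

(** The elements whose left translation both preserves and reflects agreement of
    [c] and [c'] form a subgroup.  It contains [S]: the rule for [s] gives
    preservation, and the rule for [s^-1] gives reflection.  The latter is
    needed because [f s] is not assumed to be injective. *)
Lemma labelling_unique (S : set G) (T : Type) (f : G -> T -> T)
    (c c' : G -> T) :
    smallest (@subgroup G) S = [set: G] ->
    (forall s x, S s \/ S s^-1 -> c (s * x) = f s (c x)) ->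
    (forall s x, S s \/ S s^-1 -> c' (s * x) = f s (c' x)) ->
  c 1 = c' 1 -> c = c'.
Proof.
move=> genS cf cf' c1.
pose E := [set g | forall x, c (g * x) = c' (g * x) <-> c x = c' x].
have sE : subgroup E.
  apply: subgroupP => [x|g h Eg Eh x]; first by rewrite mul1g.
  by rewrite -mulgA Eg -Eh mulVKg.
have SE : S `<=` E.
  move=> s Ss x; split=> [csx|cx]; last by rewrite cf ?cf' ?cx; auto.
  have SV : S s^-1 \/ S s^-1^-1 by right; rewrite invgK.
  by rewrite -(mulKg s x) cf// cf'// csx.
apply/funext => g; rewrite -(mulg1 g).
have Eg : E g by apply: (smallest_sub sE SE); rewrite genS.
by apply/Eg.
Qed.

(** The pair of the table of the generators and their inverses on the labels and
    the label of 1 ranges over a finite type, and [D] can be recovered from it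
    as [stab], by uniqueness of the labelling that it describes. *)
Lemma finite_small_index_subgroups n : finitely_generated G ->
  finite_set [set D : set G |
    [/\ subgroup D, finite_index D & subgroup_index D <= n]].
Proof.
move=> [S finS genS].
(* [X] is the set of generators and their inverses. *)
have [X XE] : exists X : {fset G}, S `|` [set s^-1 | s in S] = [set` X].
  by apply/finite_fsetP; rewrite finite_setU; split=> //; exact: finite_image.
have XP s : S s \/ S s^-1 -> s \in X.
  move=> Ss; suff: [set` X] s by [].
  rewrite -XE; case: Ss => [|SV]; [by left|right].
  by exists s^-1; rewrite ?invgK.
(* The value [i] outside [X] is a default. *)
pose act (t : {ffun X -> {ffun 'I_n.+1 -> 'I_n.+1}}) (s : G) (i : 'I_n.+1) :=
  if insub s is Some s' then t s' i else i.
pose stab (p : {ffun X -> {ffun 'I_n.+1 -> 'I_n.+1}} * 'I_n.+1) : set G :=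
  [set g | forall c : G -> 'I_n.+1, c 1 = p.2 ->
    (forall s x, S s \/ S s^-1 -> c (s * x) = act p.1 s (c x)) -> c g = p.2].
apply: (sub_finite_set _ (finite_image stab (@finite_finset _ setT))).
move=> D [sD fD leDn].
have [c cP] := coset_labelling _ _ sD fD leDn.
(* [r i] represents the coset labelled [i], when there is one. *)
have /choice[r rP] i : exists x, (exists y, c y = i) -> c x = i.
  have [[y cy]|nex] := pselect (exists y, c y = i); first by exists y.
  by exists 1 => /nex.
have cr x : c (r (c x)) = c x by apply: rP; exists x.
pose t := [ffun s : X => [ffun i => c (val s * r i)]].
have ct s x : S s \/ S s^-1 -> c (s * x) = act t s (c x).
  move=> /XP sX; rewrite /act insubT !ffunE /= cP invgM mulgA.
  by rewrite -[_ * s^-1 * s]mulgA mulVg mulg1 -cP cr.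
exists (t, c 1) => //; apply/seteqP; split=> g /=.
  by move=> /(_ c erefl ct)/esym/cP; rewrite invg1 mul1g.
move=> Dg c' c'1 c't; rewrite -(labelling_unique _ _ _ _ _ genS ct c't)//.
by apply/esym/cP; rewrite invg1 mul1g.
Qed.

Lemma LambdaP n : finitely_generated G ->
  subgroup (@Lambda G n) /\ finite_index (@Lambda G n).
Proof.
move=> fgG; split; first by apply: subgroup_bigcap => D [].
apply: finite_index_bigcap; first exact: finite_small_index_subgroups.
by move=> D [].
Qed.

Lemma residually_finite_separation (s : seq G) :
    residually_finite G -> 1 \notin s ->
  exists D, [/\ subgroup D, finite_index D & forall x, x \in s -> ~ D x].
Proof.
move=> rfG; elim: s => [_|x s IHs].
  by exists setT; split=> //; [exact: subgroupP|exact: finite_indexT].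
rewrite in_cons negb_or => /andP[x1 /IHs[D [sD fD Ds]]].
have [E [[sE fE] nEx]] : exists E, (subgroup E /\ finite_index E) /\ ~ E x.
  apply: contrapT => nE; move/eqP: x1; apply.
  suff : [set 1] x by move->.
  rewrite -rfG => E PE; apply: contrapT => nEx; apply: nE.
  by exists E.
exists (E `&` D); split; last 1 first.
- by move=> y; rewrite in_cons => /orP[/eqP->|/Ds nDy] [].
- apply: subgroupP => [|y z [Ey Dy] [Ez Dz]]; first by split; exact: subgroup1.
  by split; apply: subgroupM => //; apply: subgroupV.
- exact: finite_indexI.
Qed.

Lemma large_index n : infinite_set [set: G] -> residually_finite G ->
  exists D, [/\ subgroup D, finite_index D & n <= subgroup_index D].
Proof.
move=> infG rfG.
have [B _ leB] := infinite_set_fset n infG.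
(* The quotients that [D] has to avoid for the cosets of [B] to be distinct. *)
pose s := [seq g <- [seq x^-1 * y | x <- B, y <- B] | g != 1].
have [|D [sD fD Ds]] := residually_finite_separation s rfG.
  by rewrite mem_filter eqxx.
exists D; split=> //; apply: (leq_trans leB).
pose coset x := [set x * d | d in D].
have coset_inj : {in B &, injective coset}.
  move=> x y xB yB /eq_left_coset => /(_ sD) Dxy.
  apply: contrapT => nxy; apply: (Ds _ _ Dxy).
  rewrite mem_filter; apply/andP; split; last first.
    by apply/allpairsP; exists (x, y).
  by apply/eqP => /(congr1 (fun z => x * z)); rewrite mulVKg mulg1 => /esym.
rewrite -(card_in_imfset imfset_key coset_inj).
apply/fsubset_leq_card/fsubsetP => _ /imfsetP[x _ ->].
by rewrite in_fset_set//; apply/mem_set; exists x.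
Qed.

End Subgroups.

Theorem mainTheorem1 (G : groupType)
  (G_infinite : infinite_set [set: G])
  (G_fg : finitely_generated G)
  (G_rf : residually_finite G) :
  infinite_set [set n : nat | 0 < n /\ n <= intersection_growth G n].
Proof.
move=> /finite_seqP[s sE].
have [D [sD fD ltD]] := large_index (\max_(n <- s) n).+1 G_infinite G_rf.
have : subgroup_index D \in s.
  suff: [set` s] (subgroup_index D) by [].
  rewrite -sE; split; first exact: leq_ltn_trans ltD.
  have [sL fL] := LambdaP (subgroup_index D) G_fg.
  by apply: leq_subgroup_index => // x; apply.
by move=> Ds; move: ltD; rewrite ltnNge => /negP; apply; exact: leq_bigmax_seq.
Qed.
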